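(* Let $\Gamma$ be a finitely generated group with finite generating set $S$, and let $(N_k)_{k\in\mathbb{N}}$ be a Farber sequence of $\Gamma$ whose associated sequence of Schreier graphs $\mathcal{G}=\{Sch(\Gamma,N_k,S)\}_{k\in\mathbb{N}}$ is a graph sequence (i.e. $[\Gamma:N_k]\to\infty$). Then the following are equivalent: (1) $\Gamma$ is amenable; (2) $\mathcal{G}$ has property A; (3) $\mathcal{G}$ is hyperfinite.
   Context: A graph sequence $\mathcal{G}=\{G_n\}_{n\in\mathbb{N}}$ is a sequence of finite connected graphs whose vertex degrees are bounded by a constant $d$ independent of $n$, with $\lim_{n\to\infty}|V(G_n)|=\infty$. Here $V(G)$ and $E(G)$ denote vertex and edge sets; each graph carries its path metric (ignoring orientations). For a subgroup $\Lambda\le\Gamma$, the Schreier graph $Sch(\Gamma,\Lambda,S)$ has vertex set the right cosets $\Lambda g$, $g\in\Gamma$, with a directed edge labelled $s$ from $\Lambda g$ to $\Lambda gs$ for each $s\in S$. $Cay(\Gamma,S)=Sch(\Gamma,\{1\},S)$ is the Cayley graph. A sequence of $S$-labelled finite graphs $G_n$ Benjamini–Schramm converges to $Cay(\Gamma,S)$ if for every $r\in\mathbb{N}$, the proportion of vertices $x\in V(G_n)$ such that the ball $B_r(G_n,x)$ is isomorphic, as a rooted edge-labelled (directed) graph, to the ball $B_r(Cay(\Gamma,S),e)$ around the identity tends to $1$ as $n\to\infty$. A sequence $(N_k)$ of finite index subgroups of $\Gamma$ (not necessarily normal, nested, or with trivial intersection) is a Farber sequence if $Sch(\Gamma,N_k,S)$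 Benjamini–Schramm converges to $Cay(\Gamma,S)$. Property A: $\mathcal{G}=\{G_n\}$ has property A if for every $\epsilon>0$ there exist $S_0>0$ and a function $\xi:\bigsqcup_n V(G_n)\to \ell^1(\bigsqcup_n V(G_n))$, $x\mapsto\xi_x$, such that (1) $\|\xi_x\|_1=1$ for all $x$; (2) $\xi_x$ is supported in the ball of radius $S_0$ about $x$ (vertices of different graphs being regarded as infinitely far apart); (3) $\|\xi_x-\xi_y\|_1<\epsilon$ whenever $(x,y)$ is an edge of some $G_n$. Hyperfiniteness: $\mathcal{G}$ is hyperfinite if for every $\epsilon>0$ there exist a constant $K>0$ and edge sets $E_n^\epsilon\subset E(G_n)$ ($n\in\mathbb{N}$) such that $\lim_{n\to\infty}\frac{|E_n^\epsilon|}{|V(G_n)|}<\epsilon$ and, for every $n$, each connected component of $G_n\setminus E_n^\epsilon$ contains at most $K$ vertices. *)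

(* Defs.v *)
From HB Require Import structures.
From mathcomp Require Import all_boot all_order all_algebra finmap.
From mathcomp Require Import all_classical all_reals all_analysis.
Import Order.TTheory GRing.Theory Num.Theory.
Import numFieldNormedType.Exports.

Set Implicit Arguments.
Unset Strict Implicit.
Unset Printing Implicit Defensive.

Local Open Scope classical_set_scope.
Local Open Scope card_scope.
Local Open Scope ring_scope.

(** Number of elements of a finite set (the value is 0 on infinite sets). *)
Definition ncard (T : choiceType) (A : set T) : nat := #|` fset_set A|.

(** ** Labelled directed graphs *)

(** The vertices form a subset of a carrier type [T]; [edges G (x, s, y)] is a
    directed edge from [x] to [y] labelled [s].  Loops, and parallel edges with
    distinct labels, are allowed. *)
Record lgraph (T L : choiceType) := LGraph {
  verts : set T;
  edges : set (T * L * T);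
  edges_verts : forall x s y, edges (x, s, y) -> verts x /\ verts y }.

Section Graphs.
Variables T L : choiceType.
Implicit Types G : lgraph T L.

Definition adjacent G : rel T :=
  fun x y => `[< exists s, edges G (x, s, y) \/ edges G (y, s, x) >].

(** Ball of radius [r] around [x] for the path metric. *)
Definition ball_graph G (r : nat) (x : T) : set T :=
  [set y | exists p : seq T,
     [/\ (size p <= r)%N, path (adjacent G) x p & last x p = y]].

Definition component G (x : T) : set T :=
  [set y | exists p : seq T, path (adjacent G) x p /\ last x p = y].

Definition finite_graph G : Prop :=
  finite_set (verts G) /\ finite_set (edges G).

Definition connected_graph G : Prop :=
  verts G !=set0 /\ forall x, verts G x -> verts G `<=` component G x.

(** A loop contributes 2. *)
Definition degree G (x : T) : nat :=
  (ncard [set e | edges G e /\ e.1.1 = x] +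
   ncard [set e | edges G e /\ e.2 = x])%N.

Lemma del_edges_verts G (E : set (T * L * T)) x s y :
  (edges G `\` E) (x, s, y) -> verts G x /\ verts G y.
Proof. by case=> /edges_verts. Qed.

Definition del_edges G (E : set (T * L * T)) : lgraph T L :=
  LGraph (@del_edges_verts G E).

Definition graph_sequence (G : nat -> lgraph T L) : Prop :=
  [/\ forall n, finite_graph (G n),
      forall n, connected_graph (G n),
      exists d : nat, forall n x, verts (G n) x -> (degree (G n) x <= d)%N
    & (fun n => ncard (verts (G n))) @ \oo --> \oo].

(** The disjoint union of the vertex sets. *)
Definition all_verts (G : nat -> lgraph T L) : set (nat * T) :=
  [set p | verts (G p.1) p.2].

Definition l1norm (R : realType) (G : nat -> lgraph T L) (f : nat * T -> R)
  : \bar R := \esum_(q in all_verts G) (`|f q|)%:E.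

Definition property_A (R : realType) (G : nat -> lgraph T L) : Prop :=
  forall eps : R, 0 < eps ->
  exists (S0 : nat) (xi : nat * T -> nat * T -> R),
    [/\ (0 < S0)%N,
        forall p, all_verts G p -> l1norm G (xi p) = 1%E,
        forall p q, all_verts G p -> all_verts G q -> xi p q != 0 ->
          q.1 = p.1 /\ ball_graph (G p.1) S0 p.2 q.2
      & forall n x s y, edges (G n) (x, s, y) ->
          (l1norm G (fun q => (xi (n, x) q - xi (n, y) q)%R) < eps%:E)%E].

Definition hyperfinite (R : realType) (G : nat -> lgraph T L) : Prop :=
  forall eps : R, 0 < eps ->
  exists (K : nat) (E : nat -> set (T * L * T)),
    let density : R^nat :=
      fun n => (ncard (E n))%:R / (ncard (verts (G n)))%:R in
    [/\ (0 < K)%N,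
        forall n, E n `<=` edges (G n),
        cvgn density,
        limn density < eps
      & forall n x, verts (G n) x ->
          component (del_edges (G n) (E n)) x #<= `I_K].

End Graphs.

(** ** Benjamini-Schramm convergence *)

(** Isomorphism of rooted labelled directed graphs between the induced
    subgraphs on the two balls. *)
Definition ball_iso (T T' L : choiceType) (G : lgraph T L) (H : lgraph T' L)
    (r : nat) (x : T) (o : T') : Prop :=
  exists f : T -> T',
    [/\ set_bij (ball_graph G r x) (ball_graph H r o) f,
        f x = o
      & forall u v s, ball_graph G r x u -> ball_graph G r x v ->
          (edges G (u, s, v) <-> edges H (f u, s, f v))].

Definition BS_converges (R : realType) (T T' L : choiceType)
    (G : nat -> lgraph T L) (H : lgraph T' L) (o : T') : Prop :=
  forall r : nat,
    ((ncard [set x | verts (G n) x /\ ball_iso (G n) H r x o])%:R /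
     (ncard (verts (G n)))%:R : R) @[n --> \oo] --> (1 : R).

(** ** Groups *)

Section Groups.
Variable Gam : groupType.
Implicit Types (Lam S A B : set Gam) (g h : Gam).

Definition subgroup Lam : Prop := group_closed [in Lam].

Definition generates S : Prop := smallest subgroup S = setT.

Definition right_coset Lam g : set Gam := [set (h * g)%g | h in Lam].

Definition left_translate g A : set Gam := [set (g * h)%g | h in A].

(** Von Neumann's definition: there is a left-invariant finitely additive
    probability measure on all subsets. *)
Definition amenable (R : realType) : Prop :=
  exists mu : set Gam -> R,
    [/\ forall A, 0 <= mu A,
        mu setT = 1,
        forall A B, A `&` B = set0 -> mu (A `|` B) = mu A + mu B
      & forall g A, mu (left_translate g A) = mu A].

Definition schreier_verts Lam : set (set Gam) := range (right_coset Lam).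

Definition schreier_edges Lam S : set (set Gam * Gam * set Gam) :=
  [set e | exists g s, S s /\ e = (right_coset Lam g, s, right_coset Lam (g * s)%g)].

Lemma schreier_edges_verts Lam S x s y :
  schreier_edges Lam S (x, s, y) -> schreier_verts Lam x /\ schreier_verts Lam y.
Proof. by case=> g [t [_ [-> _ ->]]]; split; eexists. Qed.

Definition schreier Lam S : lgraph (set Gam) Gam :=
  LGraph (@schreier_edges_verts Lam S).

Definition cayley S : lgraph (set Gam) Gam := schreier [set 1%g] S.

(** The identity vertex of the Cayley graph is the coset [{1} 1]. *)
Definition farber_sequence (R : realType) S (N : nat -> set Gam) : Prop :=
  [/\ forall k, subgroup (N k),
      forall k, finite_set (schreier_verts (N k))
    & BS_converges R (fun k => schreier (N k) S) (cayley S)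
        (right_coset [set 1%g] 1%g)].

End Groups.

(* Main.v *)
(**
  From an invariant mean to property A: without a Folner set, some finite [U]
  doubles every finite set, and Hall's theorem yields two piecewise translations
  with disjoint ranges, each range of mean 1.  A Folner set [F] gives
  [xi_x] := the uniform measure on [x F].

  From property A to hyperfiniteness: for a set [H] of vertices, summing the
  edge variation of the functions [x |-> xi_x y] over [y] and taking level sets
  gives a piece of [H], of bounded size, with small boundary inside [H]; remove
  it and repeat.

  From hyperfiniteness to amenability: around most vertices [x] the map
  [g |-> x g] is injective on a large ball, so the uniform measures on the
  components of [x] pull back to the group; their averages over [x] are almost
  invariant and an ultralimit of them is an invariant mean.
*)

Require Import Defs.
From mathcomp Require Import all_boot all_order all_algebra finmap.
From mathcomp Require Import all_classical all_reals all_analysis.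
From mathcomp Require Import zify lra.
Import Order.TTheory GRing.Theory Num.Theory.
Import numFieldNormedType.Exports.

Set Implicit Arguments.
Unset Strict Implicit.
Unset Printing Implicit Defensive.

Local Open Scope classical_set_scope.
Local Open Scope ring_scope.

(** * Hall's theorem for infinite families of finite sets *)

Section InfiniteHall.
Variables I X : choiceType.
Implicit Types (A : I -> {fset X}) (J K : {fset I}).

Definition hall_condition A : Prop :=
  forall J, (#|` J| <= #|` (\bigcup_(i <- J) A i)%fset|)%N.

Let update A i (D : {fset X}) : I -> {fset X} :=
  fun j => if j == i then D else A j.

(** A family violating Hall's condition after the change must contain [i], as the other sets are
    untouched. Taking [i] out of it turns the strict inequality into a weak one. *)
Lemma hall_violation A i (D : {fset X}) :
  hall_condition A -> ~ hall_condition (update A i D) ->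
  exists J, i \notin J /\
    (#|` ((\bigcup_(j <- J) A j) `|` D)%fset| <= #|` J|)%N.
Proof.
move=> hA nh.
have [J HJ] : exists J, ~ (#|` J| <= #|` (\bigcup_(i0 <- J) update A i D i0)%fset|)%N.
  by apply: contrapT => h; apply: nh => J; apply: contrapT => h'; apply: h; exists J.
have iJ : i \in J.
  apply: contrapT => iJ; apply: HJ; rewrite (_ : (\bigcup_(i0 <- J) _)%fset = (\bigcup_(i0 <- J) A i0)%fset); first exact: hA.
  apply: eq_big_seq => j jJ; rewrite /update; case: eqP => // ji.
  by rewrite ji in jJ.
exists (J `\ i)%fset; split; first by rewrite !inE eqxx.
move: HJ => /negP; rewrite -ltnNge (cardfsD1 i J) iJ add1n ltnS.
apply: leq_trans; apply/fsubset_leq_card/fsubsetP => x.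
rewrite in_fsetU => /orP[/bigfcupP[j /andP[]]|xD].
  rewrite !inE => /andP[ji jJ] _ xj; apply/bigfcupP; exists j; first by rewrite jJ.
  by rewrite /update (negbTE ji).
by apply/bigfcupP; exists i; rewrite ?iJ // /update eqxx.
Qed.

(* Rado: if neither [x] nor [y] can be dropped from [A i], submodularity of
   cardinality applied to the two violating families contradicts Hall's
   condition. *)
Lemma hall_condition_remove A i x y : hall_condition A ->
  x \in A i -> y \in A i -> x != y ->
  hall_condition (update A i (A i `\ x)%fset) \/
  hall_condition (update A i (A i `\ y)%fset).
Proof.
move=> hA xi yi xy; apply: contrapT => /not_orP[].
move=> /(hall_violation hA)[J [iJ HJ]] /(hall_violation hA)[K [iK HK]].
set P := (_ `|` _)%fset in HJ; set Q := (_ `|` _)%fset in HK.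
have HU : ((#|` (J `|` K)%fset|).+1 <= #|` (P `|` Q)%fset|)%N.
  have <- : #|` (i |` (J `|` K))%fset| = (#|` (J `|` K)%fset|).+1.
    by rewrite cardfsU1 in_fsetU (negbTE iJ) (negbTE iK).
  apply: (leq_trans (hA _)); apply/fsubset_leq_card/fsubsetP => z.
  case/bigfcupP => j; rewrite andbT in_fset1U in_fsetU => /orP[/eqP->|/orP[jJ|jK]] zj.
  - rewrite /P /Q !inE zj !andbT; case: (eqVneq z x) => [->|_] /=; last by rewrite orbT.
    by rewrite xy !orbT.
  - rewrite /P /Q in_fsetU; apply/orP; left; rewrite in_fsetU; apply/orP; left.
    by apply/bigfcupP; exists j; rewrite ?jJ.
  - rewrite /P /Q in_fsetU; apply/orP; right; rewrite in_fsetU; apply/orP; left.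
    by apply/bigfcupP; exists j; rewrite ?jK.
have HI : (#|` (J `&` K)%fset| <= #|` (P `&` Q)%fset|)%N.
  apply: (leq_trans (hA _)); apply/fsubset_leq_card/fsubsetP => z.
  case/bigfcupP => j /andP[/fsetIP[jJ jK] _] zj.
  rewrite /P /Q in_fsetI; apply/andP; split; rewrite in_fsetU; apply/orP; left;
    by apply/bigfcupP; exists j; rewrite ?jJ ?jK.
have := cardfsUI J K; have := cardfsUI P Q; lia.
Qed.

(** Zorn's lemma gives a system minimal among those below [A] that satisfy Hall's condition. By
    [hall_condition_remove] its sets are singletons, and Hall's condition for pairs makes them
    distinct. *)
Theorem infinite_hall A : hall_condition A ->
  exists phi : I -> X, injective phi /\ forall i, phi i \in A i.
Proof.
move=> hA.
pose T := {B : I -> {fset X} | hall_condition B /\ forall i, (B i `<=` A i)%fset}.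
pose R : rel T := fun B C : T => `[< forall i, (sval C i `<=` sval B i)%fset >].
have Rrefl (B : T) : R B B by apply/asboolP => i.
have Rtrans (B C D : T) : R B C -> R C D -> R B D.
  move=> /asboolP h1 /asboolP h2; apply/asboolP => i.
  exact: fsubset_trans (h2 i) (h1 i).
have Ranti (B C : T) : R B C -> R C B -> B = C.
  case: B C => B hB [C hC] /asboolP /= h1 /asboolP /= h2.
  have e : B = C by apply/funext => i; apply/eqP; rewrite eqEfsubset h1 h2.
  by subst C; congr exist; exact: Prop_irrelevance.
have [B maxB] : exists B : T, forall C, R B C -> C = B.
  apply: Zorn => // Ch tot.
  have [[B0 B0Ch]|Ch0] := pselect (exists B, Ch B); last first.
    exists (exist _ A (conj hA (fun i => fsubset_refl _))) => B CB.
    by case: Ch0; exists B.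
  (* The sets are finite, so at each index the chain attains a least set, found by minimal
     cardinality. *)
  have min i : {b : T | Ch b /\ forall C, Ch C -> (sval b i `<=` sval C i)%fset}.
    apply: cid.
    pose Q n := `[< exists2 B : T, Ch B & #|` sval B i| = n >].
    have exQ : exists n, Q n by exists #|` sval B0 i|; apply/asboolP; exists B0.
    case: (ex_minnP exQ) => n /asboolP[b bCh bn] minn; exists b; split=> // C CCh.
    case: (tot _ _ bCh CCh) => /asboolP h; last exact: h.
    have /eqP-> // : sval C i == sval b i.
    by rewrite eqEfcard h bn minn //; apply/asboolP; exists C.
  pose D i := sval (sval (min i)) i.
  (* Any finitely many indices are served by one member of the chain. Hall's condition speaks of
     finite families only, so it passes to the intersection [D]. *)
  have DCh (s : seq I) : exists2 B : T, Ch B & forall j, j \in s -> (sval B j `<=` D j)%fset.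
    elim: s => [|j s [B1 B1Ch IH]]; first by exists B0.
    have [bCh _] := svalP (min j).
    case: (tot _ _ B1Ch bCh) => /asboolP h.
      exists (sval (min j)) => // k; rewrite inE => /orP[/eqP->|ks]; last exact: fsubset_trans (h k) (IH k ks).
      exact: fsubset_refl.
    exists B1 => // k; rewrite inE => /orP[/eqP->|ks]; [exact: h|exact: IH].
  have hD : hall_condition D.
    move=> J; have [B1 B1Ch B1D] := DCh J.
    apply: (leq_trans ((svalP B1).1 J)); apply/fsubset_leq_card/fsubsetP => z.
    case/bigfcupP => j /andP[jJ _] zj; apply/bigfcupP; exists j; rewrite ?jJ //.
    exact: (fsubsetP (B1D j jJ)).
  have DA i : (D i `<=` A i)%fset by exact: (svalP (sval (min i))).2.
  exists (exist _ D (conj hD DA)) => B BCh; apply/asboolP => i /=.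
  exact: (svalP (min i)).2.
have [hB BA] := svalP B.
have sub i x y : x \in sval B i -> y \in sval B i -> x = y.
  move=> xi yi; apply/eqP; apply: contrapT => /negP xy.
  have key z : z \in sval B i -> ~ hall_condition (update (sval B) i (sval B i `\ z)%fset).
    move=> zi h.
    have sB j : (update (sval B) i (sval B i `\ z) j `<=` sval B j)%fset.
      by rewrite /update; case: eqP => // ->; exact: fsubD1set.
    have hC : forall j, (update (sval B) i (sval B i `\ z) j `<=` A j)%fset.
      by move=> j; exact: fsubset_trans (sB j) (BA j).
    have /(congr1 (fun C : T => sval C i)) /= : exist _ _ (conj h hC) = B.
      by apply: maxB; apply/asboolP => j; exact: sB.
    by rewrite /update eqxx => e; move: zi; rewrite -e !inE eqxx.
  by case: (hall_condition_remove hB xi yi xy); exact: key.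
have ne i : {x | x \in sval B i}.
  apply: cid; apply/fset0Pn; rewrite -cardfs_gt0.
  by have := hB [fset i]%fset; rewrite big_seq_fset1 cardfs1.
exists (fun i => sval (ne i)); split => [i j /= e|i]; last first.
  exact: (fsubsetP (BA i)) (svalP (ne i)).
apply/eqP; apply: contrapT => /negP ij.
(* If [i] and [j] had the same representative, their two sets would have a union of at most one
   element. *)
have := hB [fset i; j]%fset; rewrite cardfs2 ij leqNgt => /negP; apply.
apply: (@leq_ltn_trans #|` [fset (sval (ne i))]%fset|); last by rewrite cardfs1.
apply/fsubset_leq_card/fsubsetP => z /bigfcupP[k /andP[+ _]].
rewrite !inE => /orP[]/eqP -> zk; apply/eqP; last rewrite e;
  exact: sub zk (svalP (ne _)).
Qed.

End InfiniteHall.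

(** * Finitely additive measures *)

Section FinitelyAdditive.
Variables (R : realType) (X : choiceType) (mu : set X -> R).
Hypothesis mu_ge0 : forall A, 0 <= mu A.
Hypothesis mu_add : forall A B, A `&` B = set0 -> mu (A `|` B) = mu A + mu B.

Lemma additive_set0 : mu set0 = 0.
Proof. by have := @mu_add set0 set0 (setI0 _); rewrite setU0; lra. Qed.

Lemma additive_le A B : A `<=` B -> mu A <= mu B.
Proof.
move=> AB; rewrite -(setDUK AB) mu_add ?lerDl ?mu_ge0 //.
by rewrite setDE setICA setICr setI0.
Qed.

Lemma additive_bigcup (I : choiceType) (D : {fset I}) (B : I -> set X) :
  (forall i j x, i \in D -> j \in D -> B i x -> B j x -> i = j) ->
  mu (\bigcup_(i in [set` D]) B i) = \sum_(i <- D) mu (B i).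
Proof.
elim/fset1U_rect: D => [|i D iD IH] disj.
  by rewrite big_seq_fset0 set_fset0 bigcup_set0 additive_set0.
rewrite big_fsetU1 //= -IH; last by move=> j k x jD kD; apply: disj; rewrite inE ?jD ?kD orbT.
rewrite set_fsetU set_fset1 bigcup_setU bigcup_set1 mu_add //.
rewrite -subset0 => x [xi [j /= jD xj]].
have e : i = j by apply: (disj _ _ x); rewrite ?inE ?eqxx ?jD ?orbT.
by rewrite e jD in iD.
Qed.

End FinitelyAdditive.

(** * Products of finite subsets of a group *)

Section Products.
Variable Gam : groupType.
Implicit Types (A B T U F : {fset Gam}) (g : Gam).

Definition pmul A B : {fset Gam} := [fset (a * b)%g | a in A, b in B]%fset.

Definition ltrans g A : {fset Gam} := [fset (g * a)%g | a in A]%fset.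

Definition ppow T r : {fset Gam} := iter r (pmul T) [fset 1%g]%fset.

Lemma in_pmul A B a b : a \in A -> b \in B -> (a * b)%g \in pmul A B.
Proof. by move=> aA bB; apply/imfset2P; exists a => //; exists b. Qed.

Lemma pmulP A B x :
  reflect (exists a b, [/\ a \in A, b \in B & x = (a * b)%g]) (x \in pmul A B).
Proof.
apply: (iffP (imfset2P _ _ _ _ _)) => [[a aA [b bB ->]]|[a [b [aA bB ->]]]].
  by exists a, b.
by exists a => //; exists b.
Qed.

Lemma pmulA A B F : pmul A (pmul B F) = pmul (pmul A B) F.
Proof.
apply/fsetP => x; apply/pmulP/pmulP => [[a [y [aA /pmulP[b [f [bB fF ->]]] ->]]]|].
  by exists (a * b)%g, f; rewrite in_pmul // mulgA.
move=> [y [f [/pmulP[a [b [aA bB ->]]] fF ->]]].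
by exists a, (b * f)%g; rewrite in_pmul // mulgA.
Qed.

Lemma pmul1l A : pmul [fset 1%g]%fset A = A.
Proof.
apply/fsetP => x; apply/pmulP/idP => [[a [b [/fset1P-> bA ->]]]|xA].
  by rewrite mul1g.
by exists 1%g, x; rewrite mul1g inE.
Qed.

Lemma card_ltrans g A : #|` ltrans g A| = #|` A|.
Proof. by apply: card_imfset; exact: mulgI. Qed.

Lemma in_ppow_add T r q x y :
  x \in ppow T r -> y \in ppow T q -> (x * y)%g \in ppow T (r + q).
Proof.
elim: r x => [|r IH] x /=; first by rewrite inE => /eqP->; rewrite mul1g.
by move=> /pmulP[a [b [aT bT ->]]] yT; rewrite -mulgA in_pmul // IH.
Qed.

Lemma ppow1 T t : t \in T -> t \in ppow T 1.
Proof. by move=> tT; rewrite -[t]mulg1 in_pmul // inE. Qed.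

Lemma ppow_mono T r q : 1%g \in T -> (r <= q)%N -> {subset ppow T r <= ppow T q}.
Proof.
move=> T1 /subnK <-; elim: (q - r)%N => //= k IH x xT.
by rewrite -[x]mul1g in_pmul // IH.
Qed.

Lemma ppow_growth (R : realType) (T : {fset Gam}) (c : R) r F : 0 <= c ->
  (forall F', c * #|` F'|%:R <= #|` pmul T F'|%:R) ->
  c ^+ r * #|` F|%:R <= #|` pmul (ppow T r) F|%:R.
Proof.
move=> c0 h; elim: r => [|r IH]; first by rewrite expr0 mul1r pmul1l.
by rewrite /ppow iterS -pmulA exprS -mulrA; apply: le_trans (h _); rewrite ler_wpM2l.
Qed.

End Products.

(** * From an invariant mean to Folner sets *)

Section MeanToFolner.
Variables (R : realType) (Gam : groupType).
Implicit Types (A B T U F : {fset Gam}) (g : Gam).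
Variable mu : set Gam -> R.
Hypothesis mu_ge0 : forall A : set Gam, 0 <= mu A.
Hypothesis muT : mu setT = 1.
Hypothesis mu_add : forall A B : set Gam, A `&` B = set0 -> mu (A `|` B) = mu A + mu B.
Hypothesis mu_inv : forall g (A : set Gam), mu (left_translate g A) = mu A.

(* [psi] moves each point by an element of the finite set [U], so it is a
   piecewise translation. *)
Lemma mean_range U (psi : Gam -> Gam) : injective psi ->
  (forall g, (psi g * g^-1)%g \in U) -> mu (range psi) = 1.
Proof.
move=> inj hU; pose P u := [set g | (psi g * g^-1)%g = u].
have eP u g : P u g -> psi g = (u * g)%g by move=> <-; rewrite mulgVK.
(* On [P u] the map is left multiplication by [u]. Injectivity makes the translated pieces disjoint,
   invariance removes the translations, and the pieces [P u] partition the group. *)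
have -> : range psi = \bigcup_(u in [set` U]) left_translate u (P u).
  apply/seteqP; split => [_ [g _ <-]|_ [u _ [g gP <-]]].
    by exists (psi g * g^-1)%g; [exact: hU|exists g => //; rewrite mulgVK].
  by exists g => //; exact: eP.
rewrite additive_bigcup //; last first.
  move=> u v _ _ _ [g gu <-] [h hv]; rewrite -(eP u g gu) -(eP v h hv) => /inj e.
  by rewrite -gu -hv e.
under eq_bigr do rewrite mu_inv.
rewrite -additive_bigcup //; last by move=> u v x _ _; rewrite /P /= => <- <-.
by rewrite -muT; congr mu; apply/seteqP; split=> // g _; exists (psi g * g^-1)%g; [exact: hU|].
Qed.

(* Otherwise Hall's theorem would give two injective maps with disjoint
   ranges, each a piecewise translation and hence of range of mean [1]. *)
Lemma mean_no_doubling U : exists F, (#|` pmul U F| < 2 * #|` F|)%N.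
Proof.
apply: contrapT => h.
have {}h F : (2 * #|` F| <= #|` pmul U F|)%N.
  by rewrite leqNgt; apply/negP => h'; apply: h; exists F.
(* Each [g] enters in two copies, both to be sent into [U g]. A finite family of copies lying over
   [F] has at most [2 * #|F|] members, so doubling yields Hall's condition. *)
have [phi [inj hphi]] : exists phi : Gam * bool -> Gam,
    injective phi /\ forall i, phi i \in pmul U [fset i.1]%fset.
  apply: infinite_hall => J.
  pose F := [fset i.1 | i in J]%fset.
  have JF : (J `<=` [fset (g, true) | g in F] `|` [fset (g, false) | g in F])%fset.
    apply/fsubsetP => -[g b] gJ; rewrite in_fsetU; apply/orP.
    have gF : g \in F by apply/imfsetP; exists (g, b).
    by case: b {gJ}; [left|right]; apply/imfsetP; exists g.
  apply: (leq_trans (fsubset_leq_card JF)).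
  apply: (leq_trans (leq_card_fsetU _ _).1).
  have inj (b : bool) : injective (fun g : Gam => (g, b)) by move=> g g' [].
  rewrite !(card_imfset _ _ (@inj _)) /= addnn -mul2n.
  apply: (leq_trans (h F)); apply/fsubset_leq_card/fsubsetP => x /pmulP[u [g [uU /imfsetP[i iJ ->] ->]]].
  by apply/bigfcupP; exists i; rewrite ?iJ // in_pmul // inE.
have r1 b : mu (range (fun g => phi (g, b))) = 1.
  apply: (@mean_range U) => [g g' /inj[]//|g].
  by have /pmulP[u [x [uU + ->]]] := hphi (g, b); rewrite inE /= => /eqP->; rewrite mulgK.
have := @mu_add (range (fun g => phi (g, true))) (range (fun g => phi (g, false))).
rewrite !r1 => e.
have : mu (range (fun g => phi (g, true)) `|` range (fun g => phi (g, false))) <= 1.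
  by rewrite -muT; apply: additive_le.
rewrite e; first by lra.
by rewrite -subset0 => _ [[g _ <-] [g' _ /inj]].
Qed.

(** If every finite set grew by a factor [1 + eps] under [T1], then some power of [T1] would double
    every finite set, against [mean_no_doubling]. *)
Lemma mean_folner T (eps : R) : 0 < eps ->
  exists F, F != fset0 /\
    forall t, t \in T -> #|` (ltrans t F `\` F)%fset|%:R <= eps * #|` F|%:R.
Proof.
move=> eps0; pose T1 := (1%g |` T)%fset.
have [F [F0 HF]] : exists F, F != fset0 /\ #|` pmul T1 F|%:R < (1 + eps) * #|` F|%:R.
  apply: contrapT => h.
  have {}h F : (1 + eps) * #|` F|%:R <= #|` pmul T1 F|%:R.
    have [->|F0] := eqVneq F fset0; first by rewrite cardfs0 mulr0.
    by rewrite leNgt; apply/negP => h'; apply: h; exists F.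
  have [n Hn] : exists n, 2 <= (1 + eps) ^+ n.
    have [n Hn] : exists n : nat, eps^-1 <= n%:R.
      by exists (Num.truncn eps^-1).+1; apply/ltW/Num.Theory.truncnS_gt.
    exists n; apply: (@le_trans _ _ (1 + n%:R * eps)).
      have : eps^-1 * eps <= n%:R * eps by rewrite ler_wpM2r // ltW.
      by rewrite mulVf ?gt_eqF //; lra.
    (* Bernoulli's inequality. *)
    elim: n {Hn} => [|n IH]; first by rewrite mul0r addr0.
    rewrite exprS; apply: (@le_trans _ _ ((1 + eps) * (1 + n%:R * eps))).
      rewrite -natr1; have : 0 <= n%:R * (eps * eps) by rewrite mulr_ge0 // mulr_ge0 // ltW.
      by lra.
    by rewrite ler_wpM2l //; lra.
  have [F] := mean_no_doubling (ppow T1 n).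
  rewrite ltnNge => /negP; apply.
  rewrite -(@ler_nat R) natrM; apply: (le_trans _ (@ppow_growth _ R T1 (1 + eps) n F _ h)); last by lra.
  by rewrite ler_wpM2r.
exists F; split=> // t tT.
have sub : (F `<=` pmul T1 F)%fset.
  by apply/fsubsetP => x xF; rewrite -[x]mul1g in_pmul // !inE eqxx.
(* Since [T1] contains [1], the set [T1 F] contains [F], and its excess over [F] bounds every [t F]
   minus [F] at once. *)
apply: (@le_trans _ _ #|` (pmul T1 F `\` F)%fset|%:R).
  rewrite ler_nat; apply/fsubset_leq_card/fsetSD/fsubsetP => _ /imfsetP[x xF ->].
  by rewrite in_pmul // !inE tT orbT.
rewrite cardfsDS // natrB ?fsubset_leq_card //.
by move: HF; lra.
Qed.

End MeanToFolner.

(** * Partition of a finite graph into small pieces *)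

Lemma card_fset_natr (R : realType) (T : choiceType) (A : {fset T}) (P : pred T) :
  #|` [fset x in A | P x]%fset|%:R = \sum_(x <- A) (P x)%:R :> R.
Proof.
rewrite card_fset_sum1 natr_sum big_fset /= big_mkcond.
by apply: eq_bigr => x _; case: (P x).
Qed.

Lemma fset_argmin (R : realType) (T : choiceType) (eta : T -> R) (A : {fset T}) :
  A != fset0 -> exists2 x, x \in A & forall y, y \in A -> eta x <= eta y.
Proof.
elim/fset1U_rect: A => [|a A _ IH _]; first by rewrite eqxx.
have [->|/IH[x xA Hx]] := eqVneq (A : {fset T}) fset0.
  by exists a; rewrite ?fsetU0 ?inE // => y; rewrite inE => /eqP->.
have [le|/ltW le] := lerP (eta a) (eta x).
  exists a; rewrite ?inE ?eqxx // => y; rewrite !inE => /orP[/eqP->//|/Hx].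
  exact: le_trans.
exists x; rewrite ?inE ?xA ?orbT // => y; rewrite !inE => /orP[/eqP->//|].
exact: Hx.
Qed.

Section FinitePartition.
Variables (R : realType) (T L : choiceType) (E : {fset T * L * T}).
Implicit Types (H A : {fset T}) (eta : T -> R).

Definition inner_edges H : {fset T * L * T} :=
  [fset e in E | (e.1.1 \in H) && (e.2 \in H)]%fset.

(** The boundary is relative to [H]: edges leaving [H] were already paid for when earlier pieces
    were removed. *)
Definition boundary H A : {fset T * L * T} :=
  [fset e in inner_edges H | (e.1.1 \in A) != (e.2 \in A)]%fset.

Lemma inner_edgesP H e :
  (e \in inner_edges H) = [&& e \in E, e.1.1 \in H & e.2 \in H].
Proof. by rewrite !inE. Qed.

Lemma boundaryP H A e :
  (e \in boundary H A) =
  (e \in inner_edges H) && ((e.1.1 \in A) != (e.2 \in A)).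
Proof. by rewrite !inE. Qed.

(* Layer cake: peel off from [eta] the multiple of the indicator of its support
   given by its least positive value. *)
Lemma layer_cake (c : R) H eta : (forall x, 0 <= eta x) ->
  (forall A, (A `<=` H)%fset -> A != fset0 -> (forall x, x \in A -> 0 < eta x) ->
     c * #|` A|%:R < #|` boundary H A|%:R) ->
  c * (\sum_(x <- H) eta x) <= \sum_(e <- inner_edges H) `|eta e.1.1 - eta e.2| /\
  ((exists2 x, x \in H & 0 < eta x) ->
  c * (\sum_(x <- H) eta x) < \sum_(e <- inner_edges H) `|eta e.1.1 - eta e.2|).
Proof.
have [n] := ubnP #|` [fset x in H | 0 < eta x]%fset|.
elim: n eta => // n IH eta; set A := [fset x in H | _]%fset => An eta0 hA.
have AP x : (x \in A) = (x \in H) && (0 < eta x) by rewrite !inE.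
have nA x : x \in H -> x \notin A -> eta x = 0.
  by move=> xH; rewrite AP xH /= -leNgt => h; apply/eqP; rewrite eq_le h eta0.
have [A0|A0] := eqVneq A fset0.
  split; last by move=> [x xH x0]; have := AP x; rewrite A0 inE xH x0.
  rewrite big_seq big1 ?mulr0 ?sumr_ge0 // => x xH.
  by apply: nA => //; rewrite A0 inE.
have AH : (A `<=` H)%fset by apply/fsubsetP => x; rewrite AP => /andP[].
suff h : c * (\sum_(x <- H) eta x) < \sum_(e <- inner_edges H) `|eta e.1.1 - eta e.2|.
  by split=> // ; exact: ltW.
have [x0 x0A minx0] := fset_argmin eta A0.
set m := eta x0 in minx0.
have m0 : 0 < m by move: x0A; rewrite AP => /andP[].
pose eta' x := eta x - m * (x \in A)%:R.
have eta'0 x : 0 <= eta' x.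
  rewrite /eta'; case: (boolP (x \in A)) => xA /=; rewrite ?mulr1 ?mulr0 ?subr0 ?subr_ge0 ?eta0 //.
  exact: minx0.
have supp x : x \in H -> 0 < eta' x -> x \in A.
  move=> xH; apply: contraTT => xA.
  by rewrite /eta' (negbTE xA) mulr0 subr0 nA // ltxx.
(* The minimiser [x0] leaves the support of [eta'], so the induction on the size of the support
   applies. *)
have [] := IH eta' _ eta'0.
- rewrite -ltnS; apply: leq_trans An; rewrite ltnS; apply: fproper_ltn_card; rewrite fproperE; apply/andP; split.
    by apply/fsubsetP => x; rewrite !inE => /andP[/= xH] /(supp _ xH); rewrite AP xH.
  apply/negP => /fsubsetP/(_ x0 x0A).
  by rewrite !inE /= /eta' x0A mulr1 subrr ltxx andbF.
- move=> B BH B0 Bpos; apply: hA => // x xB.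
  have := supp x (fsubsetP BH x xB) (Bpos x xB).
  by rewrite AP => /andP[].
move=> IH1 _.
have -> : \sum_(x <- H) eta x = \sum_(x <- H) eta' x + m * #|` A|%:R.
  rewrite (eq_bigr (fun x => eta' x + m * (x \in A)%:R)); last by move=> x _; rewrite /eta' subrK.
  rewrite big_split /= -mulr_sumr; congr (_ + _ * _).
  rewrite -card_fset_natr; congr (#|` _|%:R); apply/fsetP => x.
  by rewrite !inE /= andbA andbb.
(* An edge not crossing the boundary of [A] keeps its variation. A crossing edge has value [0] at
   its end outside [A] and at least [m] at the other, so it loses exactly [m]. *)
have -> : \sum_(e <- inner_edges H) `|eta e.1.1 - eta e.2| =
   \sum_(e <- inner_edges H) `|eta' e.1.1 - eta' e.2| + m * #|` boundary H A|%:R.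
  rewrite /boundary card_fset_natr mulr_sumr -big_split /=.
  apply: eq_big_seq => e; rewrite inner_edgesP => /and3P[_ h1 h2]; rewrite /eta'.
  case: (boolP (e.1.1 \in A)) => e1; case: (boolP (e.2 \in A)) => e2 /=;
    rewrite ?mulr1 ?mulr0 ?subr0 ?addr0 //; first by congr `|_|; lra.
  - by rewrite (nA _ h2 e2) !subr0 !ger0_norm ?subr_ge0 ?eta0 ?minx0 // subrK.
  - by rewrite (nA _ h1 e1) !sub0r !normrN !ger0_norm ?subr_ge0 ?eta0 ?minx0 // subrK.
have := hA A AH A0 (fun x xA => proj2 (andP (etrans (esym (AP x)) xA))).
rewrite -(ltr_pM2l m0) mulrDr; move: IH1; lra.
Qed.

Section Pieces.
Variables (V : {fset T}) (xi : T -> T -> R) (delta : R) (d K : nat).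
Hypothesis delta_ge0 : 0 <= delta.
Hypothesis xi_ge0 : forall x y, 0 <= xi x y.
Hypothesis xi_sum : forall x, x \in V -> \sum_(y <- V) xi x y = 1.
Hypothesis xi_edge : forall e, e \in E ->
  \sum_(y <- V) `|xi e.1.1 y - xi e.2 y| <= delta.
Hypothesis degE : forall H, (#|` inner_edges H| <= d * #|` H|)%N.
Hypothesis xi_card : forall y, y \in V -> (#|` [fset x in V | (0 < xi x y)%R]%fset| <= K)%N.

(* Summing the layer cake inequality over the columns [xi ^~ y]. *)
Lemma piece_exists H : (H `<=` V)%fset -> H != fset0 ->
  exists A, [/\ (A `<=` H)%fset, A != fset0, (#|` A| <= K)%N &
    #|` boundary H A|%:R <= delta * d%:R * #|` A|%:R].
Proof.
move=> HV H0; apply: contrapT => no.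
set c := delta * d%:R in no.
have big y A : y \in V -> (A `<=` H)%fset -> A != fset0 -> (forall x, x \in A -> 0 < xi x y) ->
    c * #|` A|%:R < #|` boundary H A|%:R.
  move=> yV AH A0 Apos; rewrite ltNge; apply/negP => le; apply: no; exists A; split=> //.
  apply: leq_trans (xi_card yV); apply/fsubset_leq_card/fsubsetP => x xA.
  by rewrite !inE /= Apos // (fsubsetP HV) // (fsubsetP AH).
have cake y yV := layer_cake (fun x => xi_ge0 x y) (fun A => @big y A yV).
have [x0 x0H] : exists x, x \in H by apply/fset0Pn.
have x0V := fsubsetP HV x0 x0H.
have [y0 y0V xi0] : exists2 y, y \in V & 0 < xi x0 y.
  apply: contrapT => h.
  have s0 : \sum_(y <- V) xi x0 y = 0.
    rewrite big_seq; apply: big1 => y yV; apply/eqP.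
    rewrite eq_le xi_ge0 andbT leNgt; apply/negP => y0; apply: h; by exists y.
  by move: (xi_sum x0V); rewrite s0 => /esym/eqP; rewrite oner_eq0.
have lt : \sum_(y <- V) c * (\sum_(x <- H) xi x y) <
    \sum_(y <- V) \sum_(e <- inner_edges H) `|xi e.1.1 y - xi e.2 y|.
  rewrite (big_fsetD1 y0) //= [ltRHS](big_fsetD1 y0) //= ltr_leD //.
    by apply: (cake y0 y0V).2; exists x0.
  rewrite big_seq [leRHS]big_seq; apply: ler_sum => y.
  by rewrite in_fsetD1 => /andP[_ yV]; exact: (cake y yV).1.
move: lt; rewrite -mulr_sumr exchange_big /= [X in _ < X]exchange_big /=.
have -> : \sum_(x <- H) \sum_(y <- V) xi x y = #|` H|%:R.
  rewrite card_fset_sum1 natr_sum; apply: eq_big_seq => x xH.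
  by apply: xi_sum; exact: (fsubsetP HV).
apply/negP; rewrite -leNgt.
apply: (@le_trans _ _ (\sum_(e <- inner_edges H) delta)).
  rewrite big_seq [leRHS]big_seq; apply: ler_sum => e.
  by rewrite inner_edgesP => /and3P[eE _ _]; exact: xi_edge.
rewrite big_const_seq count_predT iter_addr_0 -[leLHS]mulr_natr.
rewrite /c -mulrA -natrM.
by rewrite ler_wpM2l // ler_nat; exact: degE.
Qed.

Lemma partition_exists H : (H `<=` V)%fset -> exists k : T -> T,
  [/\ forall x, x \in H -> k x \in H,
      forall i, (#|` [fset x in H | k x == i]%fset| <= K)%N &
      #|` [fset e in inner_edges H | k e.1.1 != k e.2]%fset|%:R <=
        delta * d%:R * #|` H|%:R].
Proof.
have [n] := ubnP #|` H|; elim: n H => // n IH H Hn HV.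
have [->|H0] := eqVneq H fset0.
  exists id; split=> // [i|].
    rewrite (_ : [fset x in _ | _]%fset = fset0) ?cardfs0 //.
    by apply/fsetP => x; rewrite !inE.
  rewrite (_ : [fset x in _ | _]%fset = fset0) ?cardfs0 ?mulr0 //.
  by apply/fsetP => x; rewrite !inE /= andbF.
have [A [AH A0 AK Abd]] := piece_exists HV H0.
have [a aA] : exists x, x \in A by apply/fset0Pn.
pose H' := (H `\` A)%fset.
have H'P x : (x \in H') = (x \notin A) && (x \in H) by rewrite !inE.
have cH : #|` H| = (#|` A| + #|` H'|)%N by rewrite cardfsDS // subnKC // fsubset_leq_card.
have [||k [kH kK kE]] := IH H'.
- by rewrite -ltnS; apply: leq_trans Hn; rewrite ltnS cH -[ltnLHS]add0n ltn_add2r cardfs_gt0.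
- exact: fsubset_trans (fsubsetDl _ _) HV.
exists (fun x => if x \in A then a else k x); split.
- move=> x xH; case: ifPn => xA; first exact: (fsubsetP AH).
  by have := kH x; rewrite !H'P xA xH => /(_ isT) /andP[].
- move=> i; have [->|ia] := eqVneq i a.
    apply: leq_trans AK; apply/fsubset_leq_card/fsubsetP => x.
    rewrite !inE /= => /andP[xH]; case: ifPn => // xA /eqP kx.
    by have := kH x; rewrite !H'P xA xH kx aA => /(_ isT).
  apply: leq_trans (kK i); apply/fsubset_leq_card/fsubsetP => x.
  rewrite !inE /= => /andP[->]; case: ifPn => // _ /eqP ai.
  by rewrite ai eqxx in ia.
apply: (@le_trans _ _ (#|` boundary H A| +
    #|` [fset e in inner_edges H' | k e.1.1 != k e.2]%fset|)%:R); last first.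
  by rewrite natrD cH natrD mulrDr lerD.
rewrite ler_nat; apply: leq_trans (leq_card_fsetU _ _).1.
apply/fsubset_leq_card/fsubsetP => e; rewrite in_fsetU boundaryP.
rewrite !inE /= => /andP[/and3P[-> h1 h2]]; rewrite h1 h2 /=.
by case: (e.1.1 \in A); case: (e.2 \in A); rewrite ?eqxx ?orbT.
Qed.

End Pieces.

End FinitePartition.

Lemma ball_graphS (T L : choiceType) (G : lgraph T L) r (x y z : T) :
  ball_graph G r x y -> Defs.adjacent G y z -> ball_graph G r.+1 x z.
Proof.
move=> [p [pr pp <-]] adj; exists (rcons p z).
by rewrite size_rcons rcons_path last_rcons pp adj.
Qed.

Lemma ball_graph_mono (T L : choiceType) (G : lgraph T L) r q (x : T) :
  (r <= q)%N -> ball_graph G r x `<=` ball_graph G q x.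
Proof. by move=> rq y [p [pr pp pl]]; exists p; split=> //; exact: leq_trans rq. Qed.

Section SchreierGraphs.
Variables (Gam : groupType) (S : set Gam).
Hypothesis finS : finite_set S.
Implicit Types (x y Lam : set Gam) (g h s t : Gam).

Definition sym_gens : {fset Gam} :=
  (1%g |` (fset_set S `|` [fset s^-1%g | s in fset_set S]))%fset.

Lemma right_cosetM x g h : right_coset (right_coset x g) h = right_coset x (g * h)%g.
Proof.
apply/seteqP; split => [_ [_ [k xk <-] <-]|_ [k xk <-]].
  by exists k => //; rewrite mulgA.
by exists (k * g)%g; [exists k|rewrite mulgA].
Qed.

Lemma right_coset1 x : right_coset x 1%g = x.
Proof.
apply/seteqP; split => [_ [k xk <-]|k xk]; first by rewrite mulg1.
by exists k => //; rewrite mulg1.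
Qed.

Lemma right_coset_inj g : injective (fun x => right_coset x g).
Proof.
move=> x y /(congr1 (fun z => right_coset z g^-1%g)).
by rewrite !right_cosetM mulgV !right_coset1.
Qed.

Lemma schreier_vertsM Lam x g :
  schreier_verts Lam x -> schreier_verts Lam (right_coset x g).
Proof. by move=> [h _ <-]; exists (h * g)%g; rewrite ?right_cosetM. Qed.

Lemma schreier_edgesE Lam x s y : edges (schreier Lam S) (x, s, y) <->
  [/\ schreier_verts Lam x, S s & y = right_coset x s].
Proof.
split=> [[g [t [St [-> -> ->]]]]|[[g _ <-] Ss ->]].
  by split=> //; [exists g|rewrite right_cosetM].
by exists g, s; split=> //; rewrite right_cosetM.
Qed.

Lemma mem_sym_gens t :
  t \in sym_gens <-> [\/ t = 1%g, S t | S t^-1%g].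
Proof.
rewrite !in_fsetU in_fset1 in_fset_set //; split.
  case/or3P => [/eqP->|/set_mem St|/imfsetP[s + ->]]; [exact: Or31|exact: Or32|].
  by rewrite /= in_fset_set // => /set_mem Ss; apply: Or33; rewrite invgK.
case=> [->|St|St]; first by rewrite eqxx.
  by rewrite mem_set ?orbT.
apply/or3P; apply: Or33; apply/imfsetP; exists t^-1%g; rewrite ?invgK //=.
by rewrite in_fset_set // mem_set.
Qed.

Lemma sym_gens1 : 1%g \in sym_gens.
Proof. by apply/mem_sym_gens; apply: Or31. Qed.

Lemma sym_gensV t : t \in sym_gens -> t^-1%g \in sym_gens.
Proof.
move=> /mem_sym_gens H; apply/mem_sym_gens.
by case: H => [->|St|St]; rewrite ?invg1 ?invgK; [exact: Or31|exact: Or33|exact: Or32].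
Qed.

Lemma adjacent_sym_gens Lam x y : Defs.adjacent (schreier Lam S) x y ->
  exists2 t, t \in sym_gens & y = right_coset x t.
Proof.
move=> /asboolP[s [] /schreier_edgesE[_ Ss ->]].
  by exists s => //; apply/mem_sym_gens; exact: Or32.
exists s^-1%g; first by apply/mem_sym_gens; apply: Or33; rewrite invgK.
by rewrite right_cosetM mulgV right_coset1.
Qed.

Lemma sym_gens_adjacent Lam x t : schreier_verts Lam x -> t \in sym_gens ->
  t = 1%g \/ Defs.adjacent (schreier Lam S) x (right_coset x t).
Proof.
move=> Vx /mem_sym_gens[->|St|St]; [by left|right|right]; apply/asboolP.
  by exists t; left; apply/schreier_edgesE.
exists t^-1%g; right; apply/schreier_edgesE; split=> //; first exact: schreier_vertsM.
by rewrite right_cosetM mulgV right_coset1.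
Qed.

Lemma path_ppow Lam x p : path (Defs.adjacent (schreier Lam S)) x p ->
  exists2 w, w \in ppow sym_gens (size p) & last x p = right_coset x w.
Proof.
elim: p x => [|y p IH] x /=; first by exists 1%g; rewrite ?right_coset1 // inE.
move=> /andP[/adjacent_sym_gens[t tT ->] /IH[w wp ->]].
by exists (t * w)%g; [exact: in_pmul|rewrite right_cosetM].
Qed.

Lemma ball_ppow Lam r x y : ball_graph (schreier Lam S) r x y ->
  exists2 w, w \in ppow sym_gens r & y = right_coset x w.
Proof.
move=> [p [pr /path_ppow[w wp lw] <-]]; exists w => //.
exact: ppow_mono sym_gens1 pr w wp.
Qed.

Lemma ppow_ball Lam r x w : schreier_verts Lam x -> w \in ppow sym_gens r ->
  ball_graph (schreier Lam S) r x (right_coset x w).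
Proof.
elim: r x w => [|r IH] x w Vx /=.
  by rewrite inE => /eqP->; exists [::]; rewrite right_coset1.
move=> /pmulP[t [v [tT vr ->]]].
have [p [pr pp pl]] := IH _ _ (schreier_vertsM t Vx) vr.
case: (sym_gens_adjacent Vx tT) => [t1|adj].
  exists p; rewrite t1 in pp pl *; rewrite right_coset1 in pp pl.
  by rewrite mul1g; split=> //; exact: leqW.
by exists (right_coset x t :: p); rewrite /= ltnS pr adj pp pl right_cosetM.
Qed.

Lemma generates_ppow g : generates S -> exists r, g \in ppow sym_gens r.
Proof.
move=> genS; suff : [set h | exists r, h \in ppow sym_gens r] g by [].
have : smallest (@subgroup Gam) S g by rewrite genS.
apply: smallest_sub; last first.
  by move=> s Ss; exists 1%N; apply: ppow1; apply/mem_sym_gens; exact: Or32.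
have inv h r : h \in ppow sym_gens r -> h^-1%g \in ppow sym_gens r.
  elim: r h => [|r IH] h /=; first by rewrite !inE => /eqP->; rewrite invg1.
  move=> /pmulP[t [v [tT vr ->]]]; rewrite invgM.
  have := in_ppow_add (IH _ vr) (ppow1 (sym_gensV tT)).
  by rewrite addn1.
split; first by apply/mem_set; exists 0%N; rewrite inE.
move=> h k /set_mem[r hr] /set_mem[q kq]; apply/mem_set.
by exists (r + q)%N; apply: in_ppow_add => //; exact: inv.
Qed.

Lemma generates_ppow_fset (F : {fset Gam}) : generates S ->
  exists2 r, (0 < r)%N & {subset F <= ppow sym_gens r}.
Proof.
move=> genS; elim/fset1U_rect: F => [|g F _ [r r0 IH]]; first by exists 1%N.
have [q gq] := generates_ppow g genS; exists (r + q)%N; first by rewrite addn_gt0 r0.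
move=> h; rewrite !inE => /orP[/eqP->|/IH].
  exact: ppow_mono sym_gens1 (leq_addl _ _) _ gq.
exact: ppow_mono sym_gens1 (leq_addr _ _) _.
Qed.

(* An isomorphism onto the Cayley ball carries [x g] to [g], since it follows
   labelled edges. *)
Lemma ball_iso_inj Lam r x g h : schreier_verts Lam x ->
  ball_iso (schreier Lam S) (cayley S) r x (right_coset [set 1%g] 1%g) ->
  g \in ppow sym_gens r -> h \in ppow sym_gens r ->
  right_coset x g = right_coset x h -> g = h.
Proof.
move=> Vx [f [_ fx fe]].
pose G := schreier Lam S.
have key j : forall i u k w, ball_graph G i x u -> schreier_verts Lam u ->
    f u = right_coset [set 1%g] k -> w \in ppow sym_gens j -> (i + j <= r)%N ->
    f (right_coset u w) = right_coset [set 1%g] (k * w)%g.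
  elim: j => [|j IH] i u k w bu Vu fu /=.
    by rewrite inE => /eqP-> _; rewrite right_coset1 mulg1.
  move=> /pmulP[t [v [tT vj ->]]] ij.
  rewrite -(right_cosetM u) mulgA.
  have Vut := schreier_vertsM t Vu.
  case: (sym_gens_adjacent Vu tT) => [t1|adj].
    rewrite t1 mulg1 right_coset1; apply: (IH i) => //.
    by apply: leq_trans ij; rewrite leq_add2l.
  have but : ball_graph G i.+1 x (right_coset u t) by exact: ball_graphS bu adj.
  apply: (IH i.+1) => //; last by rewrite addSnnS.
  have ir : (i.+1 <= r)%N by apply: leq_trans ij; rewrite addnS ltnS leq_addr.
  have br := ball_graph_mono ir but; have bur := ball_graph_mono (ltnW ir) bu.
  case/mem_sym_gens: tT => [->|St|St]; first by rewrite right_coset1 mulg1.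
    have /(fe _ _ _ bur br)/schreier_edgesE[_ _ ->] : edges G (u, t, right_coset u t).
      exact/schreier_edgesE.
    by rewrite fu right_cosetM.
  have /(fe _ _ _ br bur)/schreier_edgesE[_ _] : edges G (right_coset u t, t^-1%g, u).
    by apply/schreier_edgesE; rewrite right_cosetM mulgV right_coset1.
  by rewrite fu -right_cosetM => ->; rewrite right_cosetM mulVg right_coset1.
have bx : ball_graph G 0 x x by exists [::].
move=> gr hr e.
have := key r 0%N x 1%g h bx Vx fx hr (leqnn _).
rewrite -e (key r 0%N x 1%g g bx Vx fx gr (leqnn _)) !mul1g => /seteqP[+ _].
move=> /(_ g)[]; first by exists 1%g; rewrite ?mul1g.
by move=> _ ->; rewrite mul1g.
Qed.

End SchreierGraphs.

Lemma ultra_cvg_segment (R : realType) (I : Type) (U : set_system I) (f : I -> R)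
    (a b : R) : UltraFilter U -> (forall i, a <= f i <= b) ->
  exists2 l, a <= l <= b & f @ U --> l.
Proof.
move=> UU fab.
have Uab : (f @ U) `[a, b]%classic.
  by apply: (@filterS _ U _ setT) filterT => i _ /=; rewrite in_itv /= fab.
have [l [lab cl]] := @segment_compact R a b (f @ U) _ Uab.
exists l => [|B lB]; first by move: lab; rewrite /= in_itv.
have [//|UnB] := in_ultra_setVsetC (f @^-1` B) UU.
by have [z [nBz Bz]] := cl (~` B) B UnB lB.
Qed.

Lemma amenable_of_almost_invariant (R : realType) (Gam : groupType) (S : set Gam) :
  generates S ->
  (forall eps : R, 0 < eps -> exists mu : set Gam -> R,
    [/\ forall A, 0 <= mu A, mu setT = 1,
        forall A B, A `&` B = set0 -> mu (A `|` B) = mu A + mu B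
      & forall s A, S s -> `|mu (left_translate s A) - mu A| <= eps]) ->
  amenable Gam R.
Proof.
move=> genS hyp.
have /choice[mu Hmu] : forall n, exists mu : set Gam -> R,
    [/\ forall A, 0 <= mu A, mu setT = 1,
        forall A B, A `&` B = set0 -> mu (A `|` B) = mu A + mu B
      & forall s A, S s -> `|mu (left_translate s A) - mu A| <= harmonic n].
  by move=> n; apply: hyp; exact: harmonic_gt0.
have [U [UU ooU]] := ultraFilterLemma (eventually_filter : ProperFilter \oo).
have bnd A n : 0 <= mu n A <= 1.
  have [h0 h1 hadd _] := Hmu n; rewrite h0 /= -h1; exact: additive_le.
have /choice[m Hm] : forall A, exists l : R, 0 <= l <= 1 /\ mu n A @[n --> U] --> l.
  by move=> A; have [l l01 ml] := ultra_cvg_segment UU (bnd A); exists l.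
have uniq (f : nat -> R) (l l' : R) : f @ U --> l -> f @ U --> l' -> l = l'.
  by apply: cvg_unique; exact: Rhausdorff.
have m_gen s A : S s -> m (left_translate s A) = m A.
  move=> Ss; apply/eqP; rewrite -subr_eq0; apply/eqP.
  apply: (uniq (fun n => mu n (left_translate s A) - mu n A)).
    by apply: cvgB; exact: (Hm _).2.
  apply: (@cvg_trans _ ((fun n => mu n (left_translate s A) - mu n A) @ \oo)).
    by move=> B; exact: ooU.
  apply/norm_cvg0P; apply: (squeeze_cvgr _ (cvg_cst 0) cvg_harmonic).
  by near=> n; rewrite normr_ge0 /=; have [_ _ _] := Hmu n; apply.
have ltM g h A : left_translate g (left_translate h A) = left_translate (g * h)%g A.
  apply/seteqP; split => [_ [_ [k kA <-] <-]|_ [k kA <-]].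
    by exists k; rewrite ?mulgA.
  by exists (h * k)%g; [exists k|rewrite mulgA].
have lt1 A : left_translate 1%g A = A.
  apply/seteqP; split => [_ [k kA <-]|k kA]; first by rewrite mul1g.
  by exists k; rewrite ?mul1g.
exists m; split=> [A||A B AB|g A].
- by have [/andP[]] := Hm A.
- apply: (uniq (fun n => mu n setT)); first exact: (Hm _).2.
  rewrite (_ : (fun n => _) = cst 1); first exact: cvg_cst.
  by apply/funext => n; have [_ ->] := Hmu n.
- apply: (uniq (fun n => mu n (A `|` B))); first exact: (Hm _).2.
  rewrite (_ : (fun n => _) = (fun n => mu n A + mu n B)).
    by apply: cvgD; exact: (Hm _).2.
  by apply/funext => n; have [_ _ hadd _] := Hmu n; exact: hadd.
suff : [set h | forall A, m (left_translate h A) = m A] g by [].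
have : smallest (@subgroup Gam) S g by rewrite genS.
apply: smallest_sub => [|s Ss B]; last exact: m_gen.
split; first by apply/mem_set => B; rewrite lt1.
move=> h k /set_mem hh /set_mem kk; apply/mem_set => B.
by rewrite -ltM hh -[LHS]kk ltM mulgV lt1.
Unshelve. all: by end_near.
Qed.

Section Components.
Variables (T L : choiceType) (G : lgraph T L).
Implicit Types x y z : T.

Lemma adjacentC : symmetric (Defs.adjacent G).
Proof.
by move=> x y; apply/asboolP/asboolP => -[s [|]]; exists s; [right|left|right|left].
Qed.

Lemma component_refl x : component G x x. Proof. by exists [::]. Qed.

Lemma adjacent_component x y : Defs.adjacent G x y -> component G x = component G y.
Proof.
have sub u v : Defs.adjacent G u v -> component G v `<=` component G u.
  by move=> uv z [p [pp <-]]; exists (v :: p); rewrite /= uv.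
by move=> xy; apply/seteqP; split; apply: sub; rewrite // adjacentC.
Qed.

Lemma component_invariant (I : Type) (k : T -> I) x y :
  (forall u v, Defs.adjacent G u v -> k u = k v) -> component G x y -> k y = k x.
Proof.
move=> kinv [p [+ <-]]; elim: p x => //= z p IH x /andP[xz /IH->].
by rewrite (kinv _ _ xz).
Qed.

Lemma component_verts x : verts G x -> component G x `<=` verts G.
Proof.
move=> Vx y [p [+ <-]]; elim: p x Vx => //= z p IH x Vx /andP[xz]; apply: IH.
by case/asboolP: xz => s [] /edges_verts[].
Qed.

Lemma component_short_path K x y : (component G x #<= `I_K)%card -> component G x y ->
  exists p, [/\ (size p <= K)%N, path (Defs.adjacent G) x p & last x p = y].
Proof.
move=> cK [p [pp <-]]; case/shortenP: pp => q pq uq _; exists q; split=> //.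
have fC : finite_set (component G x) by exact: card_le_finite cK (finite_II K).
apply: leq_trans (geq_card_fset_set cK); apply: leq_trans (leqnSn _) _.
rewrite -[(size q).+1]/(size (x :: q)) -(undup_id uq) -card_fseq.
apply/fsubset_leq_card/fsubsetP => z; rewrite in_fset /= in_fset_set // => zq.
apply/mem_set; case/splitPl: zq pq => p1 p2 pz; rewrite cat_path => /andP[p1p _].
by exists p1.
Qed.

End Components.

Section HyperfiniteToAmenable.
Variables (R : realType) (Gam : groupType) (S : set Gam) (N : nat -> set Gam).
Hypothesis finS : finite_set S.
Hypothesis genS : generates S.
Hypothesis farN : farber_sequence R S N.
Hypothesis hypN : hyperfinite R (fun k => schreier (N k) S).

(* The mean of [A] is the average over the vertices [x] of the proportion of the
   component of [x], pulled back to the group by [g |-> x g], lying in [A]. *)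
Lemma hyperfinite_almost_invariant (eps : R) : 0 < eps ->
  exists mu : set Gam -> R,
    [/\ forall A, 0 <= mu A, mu setT = 1,
        forall A B, A `&` B = set0 -> mu (A `|` B) = mu A + mu B
      & forall s A, S s -> `|mu (left_translate s A) - mu A| <= eps].
Proof.
move=> eps0; have e2 : 0 < eps / 2 by rewrite divr_gt0.
have [K [E [K0 Esub Ecvg Elim EK]]] := hypN e2.
have [_ finV BS] := farN.
pose r := K.+1.
have near1 := cvgr_lt _ Ecvg _ Elim.
have e21 : 1 - eps / 2 < 1 :> R by lra.
have near2 := cvgr_gt _ (BS r) _ e21.
have [n /= [Edens good]] := filter_ex (filterI (near1 _) (near2 _)).
set G := schreier (N n) S in good.
pose V := fset_set (schreier_verts (N n)).
pose D := del_edges G (E n).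
have VP x : (x \in V) = (x \in schreier_verts (N n)) by rewrite in_fset_set.
have V_gt0 : (0 : R) < #|` V|%:R.
  rewrite ltr0n cardfs_gt0; apply/fset0Pn; exists (right_coset (N n) 1%g).
  by rewrite VP; apply/mem_set; exists 1%g.
pose C x := fset_set (component D x).
have Cfin x : x \in V -> finite_set (component D x).
  by rewrite VP => /set_mem/EK => h; apply: card_le_finite h (finite_II K).
have CP x y : x \in V -> (y \in C x) = (y \in component D x).
  by move=> xV; rewrite in_fset_set //; exact: Cfin.
have C_gt0 x : x \in V -> (0 : R) < #|` C x|%:R.
  move=> xV; rewrite ltr0n cardfs_gt0; apply/fset0Pn; exists x.
  by rewrite CP //; apply/mem_set; exact: component_refl.
have /choice[g Hg] : forall q : set Gam * set Gam, exists w,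
    q.1 \in V -> q.2 \in C q.1 ->
    w \in ppow (sym_gens S) K /\ q.2 = right_coset q.1 w.
  move=> [x y] /=; have [[xV yC]|h] := pselect (x \in V /\ y \in C x); last first.
    by exists 1%g => xV yC; case: h.
  have Vx : schreier_verts (N n) x by move: xV; rewrite VP => /set_mem.
  have Cy : component D x y by move: yC; rewrite CP // => /set_mem.
  have [p [pK pp pl]] := component_short_path (EK n x Vx) Cy.
  have ppG : path (Defs.adjacent G) x p.
    apply: sub_path pp => u v /asboolP[s [] [h _]]; apply/asboolP; exists s; by [left|right].
  have [w wr yw] : exists2 w, w \in ppow (sym_gens S) K & y = right_coset x w.
    by apply: (@ball_ppow _ _ finS (N n)); exists p.
  by exists w.
pose w x (A : set Gam) : R := (\sum_(y <- C x) (g (x, y) \in A : bool)%:R) / #|` C x|%:R.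
have w_ge0 x (A : set Gam) : 0 <= w x A by rewrite divr_ge0 // sumr_ge0.
have w_le1 x (A : set Gam) : x \in V -> w x A <= 1.
  move=> xV; rewrite ler_pdivrMr ?C_gt0 // mul1r card_fset_sum1 natr_sum.
  by apply: ler_sum => y _; rewrite ler_nat leq_b1.
have V_M x s : x \in V -> right_coset x s \in V.
  by rewrite !VP => /set_mem Vx; apply/mem_set; exact: schreier_vertsM.
have VE s : [fset right_coset x s | x in V]%fset = V.
  apply/eqP; rewrite eqEfcard card_imfset ?leqnn ?andbT //=; last exact: right_coset_inj.
  by apply/fsubsetP => _ /imfsetP[x xV ->]; exact: V_M.
pose Good := fset_set [set x | verts G x /\ ball_iso G (cayley S) r x (right_coset [set 1%g] 1%g)].
have GoodP x : (x \in Good) = (x \in [set x | verts G x /\ ball_iso G (cayley S) r x (right_coset [set 1%g] 1%g)]).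
  by rewrite in_fset_set //; apply: sub_finite_set (finV n) => y [].
have finE : finite_set (E n).
  apply: (@sub_finite_set _ _ [set (q.1, q.2, right_coset q.1 q.2) | q in schreier_verts (N n) `*` S]).
    move=> [[x s] y] /Esub/schreier_edgesE[Vx Ss ->]; by exists (x, s).
  by apply: finite_image; exact: finite_setX.
pose Ef := fset_set (E n).
have key s (A : set Gam) x : S s -> x \in V ->
    `|w x (left_translate s A) - w (right_coset x s) A| <=
    (x \notin Good)%:R + ((x, s, right_coset x s) \in Ef)%:R.
  move=> Ss xV; have xsV := V_M x s xV.
  have le1 : `|w x (left_translate s A) - w (right_coset x s) A| <= 1.
    rewrite ler_norml; apply/andP; split.
      by have := w_ge0 x (left_translate s A); have := w_le1 _ A xsV; lra.
    by have := w_ge0 (right_coset x s) A; have := w_le1 _ (left_translate s A) xV; lra.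
  have [xG|xG] /= := boolP (x \in Good); last first.
    by apply: (le_trans le1); rewrite lerDl.
  have [xE|xE] /= := boolP (_ \in Ef); first by rewrite add0r.
  rewrite addr0; have {}xG : ball_iso G (cayley S) r x (right_coset [set 1%g] 1%g).
    by move: xG; rewrite GoodP => /set_mem[].
  have Vx : schreier_verts (N n) x by move: xV; rewrite VP => /set_mem.
  have adj : Defs.adjacent D x (right_coset x s).
    apply/asboolP; exists s; left; split; first exact/schreier_edgesE.
    by move=> h; move: xE; rewrite in_fset_set // mem_set.
  have eC : C x = C (right_coset x s) by rewrite /C (adjacent_component adj).
  rewrite /w -eC -mulrBl -sumrB big_seq big1 ?mul0r ?normr0 // => y yC.
  have [h1 e1] := Hg (x, y) xV yC.
  have yC' : y \in C (right_coset x s) by rewrite -eC.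
  have [h2 e2'] := Hg (right_coset x s, y) xsV yC'.
  have -> : g (x, y) = (s * g (right_coset x s, y))%g.
    apply: (ball_iso_inj finS Vx xG).
    - exact: ppow_mono (sym_gens1 _) (leqnSn _) _ h1.
    - by apply: in_pmul => //; apply/mem_sym_gens => //; exact: Or32.
    - by rewrite -[LHS]e1 -right_cosetM -[RHS]e2'.
  have -> : ((s * g (right_coset x s, y))%g \in left_translate s A) = (g (right_coset x s, y) \in A).
    apply/idP/idP => /set_mem; last by move=> h; apply/mem_set; exists (g (right_coset x s, y)).
    by move=> [z zA /mulgI <-]; apply/mem_set.
  by rewrite subrr.
exists (fun A => (\sum_(x <- V) w x A) / #|` V|%:R); split.
- by move=> A; rewrite divr_ge0 // sumr_ge0.
- rewrite (_ : \sum_(x <- V) _ = #|` V|%:R) ?divff ?gt_eqF //.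
  rewrite card_fset_sum1 natr_sum; apply: eq_big_seq => x xV.
  rewrite /w (_ : \sum_(y <- C x) _ = #|` C x|%:R) ?divff ?gt_eqF ?C_gt0 //.
  by rewrite card_fset_sum1 natr_sum; apply: eq_bigr => y _; rewrite in_setT.
- move=> A B AB; rewrite -mulrDl -big_split; congr (_ / _); apply: eq_bigr => x _.
  rewrite /w /= -mulrDl -big_split; congr (_ / _); apply: eq_bigr => y _ /=.
  rewrite in_setU; have [aA|] := boolP (_ \in A); last by rewrite add0r.
  have [aB|] := boolP (_ \in B); last by rewrite addr0.
  have : (A `&` B) (g (x, y)) by split; exact: set_mem.
  by rewrite AB.
move=> s A Ss.
have -> : \sum_(x <- V) w x A = \sum_(x <- V) w (right_coset x s) A.
  rewrite -{1}(VE s) big_imfset //= => x y _ _; exact: right_coset_inj.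
rewrite -mulrBl -sumrB normrM [X in _ * X]ger0_norm ?invr_ge0 // ler_pdivrMr //.
apply: (le_trans (ler_norm_sum _ _ _)).
apply: (@le_trans _ _ (\sum_(x <- V) ((x \notin Good)%:R + ((x, s, right_coset x s) \in Ef)%:R))).
  by rewrite big_seq [leRHS]big_seq; apply: ler_sum => x; exact: key.
rewrite big_split /= -!card_fset_natr.
have b1 : #|` [fset x in V | (x, s, right_coset x s) \in Ef]%fset|%:R <= eps / 2 * #|` V|%:R.
  rewrite -ler_pdivrMr //; apply: le_trans (ltW Edens); rewrite ler_pM2r ?invr_gt0 //.
  pose em (x : set Gam) := (x, s, right_coset x s).
  have em_inj : injective em by move=> x y [].
  rewrite ler_nat; set B := [fset x in V | _]%fset.
  apply: (@leq_trans #|` [fset em x | x in B]%fset|); first by rewrite [leqRHS](card_imfset _ _ em_inj).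
  apply/fsubset_leq_card/fsubsetP => _ /imfsetP[x + ->].
  by rewrite !inE /= => /andP[].
have b2 : #|` [fset x in V | x \notin Good]%fset|%:R <= eps / 2 * #|` V|%:R.
  have sub : (Good `<=` V)%fset.
    by apply/fsubsetP => x; rewrite GoodP VP => /set_mem[h _]; exact/mem_set.
  have : (1 - eps / 2) * #|` V|%:R < #|` Good|%:R by rewrite -ltr_pdivlMr.
  have -> : [fset x in V | x \notin Good]%fset = (V `\` Good)%fset.
    by apply/fsetP => x; rewrite !inE /= andbC.
  by rewrite cardfsDS // natrB ?fsubset_leq_card //; lra.
by move: b1 b2; lra.
Qed.

Lemma hyperfinite_amenable : amenable Gam R.
Proof. exact: amenable_of_almost_invariant genS hyperfinite_almost_invariant. Qed.

End HyperfiniteToAmenable.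

Lemma l1norm_fiber (R : realType) (T L : choiceType) (G : nat -> lgraph T L) n
    (f : nat * T -> R) : finite_set (verts (G n)) ->
  (forall q, all_verts G q -> q.1 != n -> f q = 0) ->
  l1norm G f = (\sum_(y <- fset_set (verts (G n))) `|f (n, y)|)%:E.
Proof.
move=> fin f0; set V := fset_set _.
pose em (y : T) := (n, y); have em_inj : injective em by move=> x y [].
pose A : {fset nat * T} := [fset em y | y in V]%fset.
have AP q : (q \in A) = (q \in [set q | all_verts G q /\ q.1 = n]).
  apply/imfsetP/idP => [[y /= + ->]|/set_mem[]].
    by rewrite in_fset_set // => /set_mem Vy; apply/mem_set.
  by case: q => m y /= + e; subst m => Vy; exists y => //=; rewrite in_fset_set // mem_set.
have -> : l1norm G f = \esum_(q in [set` A]) (`|f q|)%:E.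
  rewrite /l1norm esum_mkcond [RHS]esum_mkcond; apply: eq_esum => q _.
  case: ifPn => qG; case: ifPn => //.
    rewrite notin_setE /= AP => /negP h; rewrite f0 ?normr0 //; first exact: set_mem.
    by apply: contraNneq h => e; apply/mem_set; split=> //; exact: set_mem.
  by rewrite inE /= AP => /set_mem[/mem_set h _]; rewrite h in qG.
rewrite esum_fset // fsbig_finite //= set_fsetK big_imfset /=; last by move=> ? ? _ _; exact: em_inj.
by rewrite sumEFin.
Qed.

Section AmenableToPropertyA.
Variables (R : realType) (Gam : groupType) (S : set Gam) (N : nat -> set Gam).
Hypothesis finS : finite_set S.
Hypothesis genS : generates S.
Hypothesis finV : forall k, finite_set (schreier_verts (N k)).

Lemma amenable_property_A : amenable Gam R ->
  property_A R (fun k => schreier (N k) S).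
Proof.
move=> [mu [mu0 mu1 muD muI]] eps eps0.
have e3 : 0 < eps / 3 by rewrite divr_gt0.
have [F [F0 HF]] := mean_folner mu0 mu1 muD muI (fset_set S) e3.
have [r r0 Fr] := generates_ppow_fset finS F genS.
have cF : (0 : R) < #|` F|%:R by rewrite ltr0n cardfs_gt0.
pose G k := schreier (N k) S.
pose xi (p q : nat * set Gam) : R :=
  (\sum_(h <- F) (q == (p.1, right_coset p.2 h))%:R) / #|` F|%:R.
have xi_supp p q : xi p q != 0 -> exists2 h, h \in F & q = (p.1, right_coset p.2 h).
  move=> xi0; apply: contrapT => h; move/negP: xi0; apply; apply/eqP.
  rewrite /xi big_seq big1 ?mul0r // => k kF; case: eqP => // e.
  by case: h; exists k.
have xi_fiber p q : q.1 != p.1 -> xi p q = 0.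
  by move=> qp; apply/eqP; apply: contraNT qp => /xi_supp[h _ ->].
have sum1 n x g : verts (G n) x ->
    \sum_(y <- fset_set (verts (G n))) ((n, y) == (n, right_coset x g))%:R = 1 :> R.
  move=> Vx; have xg : right_coset x g \in fset_set (verts (G n)).
    rewrite in_fset_set; last exact: finV.
    by apply/mem_set; exact: schreier_vertsM.
  rewrite (big_fsetD1 _ xg) /= eqxx big_seq big1 ?addr0 // => y.
  by rewrite !inE xpair_eqE eqxx /= => /andP[/negbTE->].
exists r, xi; split=> //.
- move=> [n x] Vx; rewrite (@l1norm_fiber _ _ _ _ n) //=; last first.
    by move=> q _ qn; exact: xi_fiber.
  congr EFin; under eq_bigr do rewrite ger0_norm ?divr_ge0 ?sumr_ge0 //.
  rewrite -mulr_suml exchange_big /=; under eq_bigr do rewrite sum1 //.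
  have -> : \sum_(h <- F) 1 = #|` F|%:R :> R by rewrite card_fset_sum1 natr_sum.
  by rewrite divff ?gt_eqF.
- move=> p q Vp Vq /xi_supp[h hF ->] /=; split=> //.
  by apply: ppow_ball => //; exact: Fr.
move=> n x s y /schreier_edgesE[Vx Ss ->].
rewrite (@l1norm_fiber _ _ _ _ n) //=; last first.
  by move=> q _ qn; rewrite !xi_fiber ?subrr.
rewrite lte_fin; pose D := (F `|` ltrans s F)%fset.
have expand (A : {fset Gam}) (phi : Gam -> R) : (A `<=` D)%fset ->
    \sum_(h <- A) phi h = \sum_(k <- D) (k \in A)%:R * phi k.
  move=> AD; rewrite (eq_big_seq (fun k => (k \in A)%:R * phi k)); last first.
    by move=> k /= ->; rewrite mul1r.
  by apply: big_fset_incl => // k _ /negbTE ->; rewrite mul0r.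
apply: (@le_lt_trans _ _ (\sum_(z <- fset_set (verts (G n))) \sum_(k <- D)
   `|(k \in F)%:R - (k \in ltrans s F)%:R| * ((n, z) == (n, right_coset x k))%:R / #|` F|%:R)).
  apply: ler_sum => z _; rewrite /xi -mulrBl normrM [X in _ * X]ger0_norm ?invr_ge0 //.
  rewrite -mulr_suml ler_wpM2r ?invr_ge0 //=.
  have -> : \sum_(h <- F) ((n, z) == (n, right_coset (right_coset x s) h))%:R =
      \sum_(k <- ltrans s F) ((n, z) == (n, right_coset x k))%:R :> R.
    rewrite big_imfset /=; last by move=> ? ? _ _; exact: mulgI.
    by apply: eq_bigr => h _; rewrite right_cosetM.
  rewrite (expand F) ?fsubsetUl // (expand (ltrans s F)) ?fsubsetUr // -sumrB.
  apply: (le_trans (ler_norm_sum _ _ _)); apply: ler_sum => k _.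
  by rewrite -mulrBl normrM [X in _ * X]ger0_norm.
rewrite exchange_big /=.
under eq_bigr do rewrite -mulr_suml -mulr_sumr sum1 // mulr1.
rewrite -mulr_suml ltr_pdivrMr //.
have cs : #|` (F `\` ltrans s F)%fset| = #|` (ltrans s F `\` F)%fset|.
  by rewrite !cardfsD card_ltrans fsetIC.
have := HF s; rewrite in_fset_set // mem_set // => /(_ isT) le.
apply: (@le_lt_trans _ _ (#|` (F `\` ltrans s F)%fset|%:R + #|` (ltrans s F `\` F)%fset|%:R)).
  have FD : (F `\` ltrans s F)%fset = [fset k in D | (k \in F) && (k \notin ltrans s F)]%fset.
    by apply/fsetP => k; rewrite !inE; case: (k \in F) => //=; rewrite ?andbF ?andbT.
  have DF : (ltrans s F `\` F)%fset = [fset k in D | (k \notin F) && (k \in ltrans s F)]%fset.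
    by apply/fsetP => k; rewrite !inE /=; case: (k \in F); rewrite //= andbb.
  rewrite FD DF !card_fset_natr -big_split /=; apply: ler_sum => k _.
  by case: (k \in F); case: (k \in ltrans s F) => /=;
    rewrite ?subrr ?normr0 ?subr0 ?sub0r ?normrN ?normr1 ?addr0 ?add0r.
rewrite cs; have : 0 < eps * #|` F|%:R by rewrite mulr_gt0.
by move: le; lra.
Qed.

End AmenableToPropertyA.

Lemma fset_between (T : choiceType) (A B : {fset T}) m : (A `<=` B)%fset ->
  (#|` A| <= m)%N -> (m <= #|` B|)%N ->
  exists C : {fset T}, [/\ (A `<=` C)%fset, (C `<=` B)%fset & #|` C| = m].
Proof.
move=> AB + mB; elim: m mB => [mB|m IH mB]; first by rewrite leqn0 => /eqP A0; exists A.
rewrite leq_eqVlt => /orP[/eqP Am|]; first by exists A.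
rewrite ltnS => /(IH (ltnW mB))[C [AC CB Cm]].
have [b] : exists b, b \in (B `\` C)%fset.
  by apply/fset0Pn; rewrite -cardfs_gt0 cardfsDS // Cm subn_gt0.
rewrite inE => /andP[bC bB]; exists (b |` C)%fset; split.
- exact: fsubset_trans AC (fsubsetU1 _ _).
- by rewrite fsubUset fsub1set bB.
- by rewrite cardfsU1 bC Cm.
Qed.

Lemma cvg_truncn_density (R : realType) (c : R) (v : nat -> nat) : 0 <= c ->
  v @ \oo --> \oo -> ((Num.truncn (c * (v n)%:R))%:R / (v n)%:R : R) @[n --> \oo] --> c.
Proof.
move=> c0 /cvgnyPge voo; apply/cvgrPdist_le => e e0.
near=> n.
have vn : (Num.truncn e^-1).+1%:R <= (v n)%:R :> R.
  by rewrite ler_nat; near: n; exact: voo.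
have ev : e^-1 < (v n)%:R by exact: lt_le_trans (Num.Theory.truncnS_gt _) vn.
have v0 : (0 : R) < (v n)%:R by apply: lt_trans ev; rewrite invr_gt0.
have /andP[t1 t2] : (Num.truncn (c * (v n)%:R))%:R <= c * (v n)%:R
    < (Num.truncn (c * (v n)%:R)).+1%:R.
  by apply: Num.Theory.truncn_itv; rewrite mulr_ge0.
rewrite ger0_norm ?subr_ge0 ?ler_pdivrMr // lerBlDr -lerBlDl ler_pdivlMr // mulrBl.
have : 1 <= e * (v n)%:R by rewrite -ler_pdivrMl // mulr1 ltW.
by move: t2; rewrite -natr1; lra.
Unshelve. all: by end_near.
Qed.

Section PropertyAToHyperfinite.
Variables (R : realType) (Gam : groupType) (S : set Gam) (N : nat -> set Gam).
Hypothesis finS : finite_set S.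
Hypothesis finV : forall k, finite_set (schreier_verts (N k)).
Hypothesis cardV : (fun k => ncard (schreier_verts (N k))) @ \oo --> \oo.

Let Sf := fset_set S.
Let V n := fset_set (schreier_verts (N n)).

Definition out_edges (H : {fset set Gam}) : {fset set Gam * Gam * set Gam} :=
  [fset (x, s, right_coset x s) | x in H, s in Sf]%fset.

Lemma card_out_edges H : #|` out_edges H| = (#|` Sf| * #|` H|)%N.
Proof.
rewrite card_fset_sum1 big_imfset2 /=; last by move=> [x s] [y t] _ _ [-> ->].
under eq_bigr do rewrite -card_fset_sum1.
by rewrite big_const_seq count_predT iter_addn_0.
Qed.

Lemma mem_schreier_fset n x : (x \in V n) = (x \in schreier_verts (N n)).
Proof. by rewrite in_fset_set. Qed.

Lemma out_edgesP n e : e \in out_edges (V n) <-> edges (schreier (N n) S) e.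
Proof.
case: e => [[x s] y]; rewrite schreier_edgesE; split.
  move=> /imfset2P[x' /= + [s' /=]]; rewrite mem_schreier_fset in_fset_set //.
  by move=> /set_mem Vx /set_mem Ss [-> -> ->].
move=> [Vx Ss ->]; apply/imfset2P; exists x; first by rewrite /= mem_schreier_fset mem_set.
by exists s => //=; rewrite in_fset_set // mem_set.
Qed.

Lemma partition_bound n (delta : R) (r : nat) (xi : set Gam -> set Gam -> R) :
  0 <= delta -> (forall x y, 0 <= xi x y) ->
  (forall x, schreier_verts (N n) x ->
     \sum_(y <- fset_set (schreier_verts (N n))) xi x y = 1) ->
  (forall x s, schreier_verts (N n) x -> S s ->
     \sum_(y <- fset_set (schreier_verts (N n))) `|xi x y - xi (right_coset x s) y| <= delta) ->
  (forall x y, schreier_verts (N n) x -> schreier_verts (N n) y -> xi x y != 0 ->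
     ball_graph (schreier (N n) S) r x y) ->
  exists E : {fset set Gam * Gam * set Gam},
    [/\ [set` E] `<=` edges (schreier (N n) S),
      (#|` E|%:R : R) <= delta * #|` Sf|%:R * (ncard (schreier_verts (N n)))%:R &
      forall E' : set _, [set` E] `<=` E' -> forall x, schreier_verts (N n) x ->
        (component (del_edges (schreier (N n) S) E') x #<=
           `I_(#|` ppow (sym_gens S) r|))%card].
Proof.
move=> d0 xi0 xi1 xid xir; have VP := mem_schreier_fset n; have outP := out_edgesP n.
have [||||k [kV kK kE]] := @partition_exists R _ _ (out_edges (V n)) (V n) xi delta #|` Sf|
    #|` ppow (sym_gens S) r| d0 xi0 _ _ _ _ (V n) (fsubset_refl _).
- by move=> x; rewrite VP => /set_mem; exact: xi1.
- by move=> [[x s] y] /outP/schreier_edgesE[Vx Ss ->]; exact: xid.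
- move=> H; rewrite -card_out_edges; apply/fsubset_leq_card/fsubsetP => -[[x s] y].
  rewrite inner_edgesP => /and3P[/imfset2P[x' /= _ [s' s'S [-> -> ->]]] x'H _].
  by apply/imfset2P; exists x' => //; exists s'.
- move=> y yV; apply: (@leq_trans #|` [fset right_coset y w^-1%g | w in ppow (sym_gens S) r]%fset|).
    apply/fsubset_leq_card/fsubsetP => x; rewrite !inE /= => /andP[xV xy].
    have [||w wr e] := ball_ppow finS (xir x y _ _ (lt0r_neq0 xy)).
    + by move: xV; rewrite VP => /set_mem.
    + by move: yV; rewrite VP => /set_mem.
    + by apply/imfsetP; exists w => //; rewrite e right_cosetM mulgV right_coset1.
  exact: leq_imfset_card.
have inner e : e \in out_edges (V n) -> e \in inner_edges (out_edges (V n)) (V n).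
  case: e => [[x s] y] eE; rewrite inner_edgesP eE /= !VP.
  by move/outP: eE => /edges_verts[Vx Vy]; rewrite !mem_set.
exists [fset e in inner_edges (out_edges (V n)) (V n) | k e.1.1 != k e.2]%fset; split=> //.
  by move=> e /=; rewrite !inE /= => /andP[/andP[/outP]].
move=> E' EE' x Vx.
have xV : x \in V n by rewrite VP mem_set.
have sub : component (del_edges (schreier (N n) S) E') x `<=`
    [set` [fset z in V n | k z == k x]%fset].
  move=> y xy; rewrite /= !inE /= VP mem_set /=; last exact: component_verts xy.
  apply/eqP; apply: component_invariant xy => u v /asboolP[s uv].
  have cut a b : edges (del_edges (schreier (N n) S) E') (a, s, b) -> k a = k b.
    move=> [ab nE']; apply: contrapT => /eqP kab; apply: nE'; apply: EE'.
    rewrite /= inE; apply/andP; split=> //; apply: inner; exact/outP.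
  by case: uv => /cut.
apply: (card_le_trans (subset_card_le sub)).
have /card_eq_fsetP/card_le_eql -> := erefl #|` [fset z in V n | k z == k x]%fset|.
by rewrite card_le_II.
Qed.

Lemma property_A_hyperfinite :
  property_A R (fun k => schreier (N k) S) -> hyperfinite R (fun k => schreier (N k) S).
Proof.
move=> pA eps eps0.
pose delta : R := eps / 2 / (#|` Sf|.+1)%:R.
have delta0 : 0 < delta by rewrite !divr_gt0.
have [r [xi [r0 xi1 xi_supp xi_edge]]] := pA _ delta0.
pose v n := ncard (schreier_verts (N n)).
pose c : R := Num.min (eps / 2) #|` Sf|%:R.
have c0 : 0 <= c by rewrite le_min ler0n andbT ltW // divr_gt0.
have fiber n x y : schreier_verts (N n) x -> all_verts (fun k => schreier (N k) S) y ->
    y.1 != n -> xi (n, x) y = 0.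
  move=> Vx Vy yn; apply/eqP; apply: contraNT yn => h.
  by have [-> //] := xi_supp (n, x) y Vx Vy h.
have hE n : exists E : set (set Gam * Gam * set Gam),
  [/\ E `<=` edges (schreier (N n) S), ncard E = Num.truncn (c * (v n)%:R) &
      forall x, schreier_verts (N n) x ->
        (component (del_edges (schreier (N n) S) E) x #<=
           `I_(#|` ppow (sym_gens S) r|))%card].
  have [||||E [Esub Ecard Ecomp]] := @partition_bound n delta r
      (fun x y => `|xi (n, x) (n, y)|) (ltW delta0).
  - by move=> x y.
  - move=> x Vx; have := xi1 (n, x) Vx; rewrite (@l1norm_fiber _ _ _ _ n); first by move=> [].
      exact: finV.
    by move=> q Vq qn; exact: fiber.
  - move=> x s Vx Ss.
    have := xi_edge n x s (right_coset x s).
    rewrite (@l1norm_fiber _ _ _ _ n); first last.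
    + by move=> q Vq qn; rewrite !fiber ?subrr //; exact: schreier_vertsM.
    + exact: finV.
    rewrite lte_fin => h; apply: le_trans (ltW (h _)); last exact/schreier_edgesE.
    by apply: ler_sum => y _; exact: ler_dist_dist.
  - move=> x y Vx Vy; rewrite normr_eq0 => h.
    by have [] := xi_supp (n, x) (n, y) Vx Vy h.
  have EV : (E `<=` out_edges (V n))%fset by apply/fsubsetP => e /Esub/out_edgesP.
  have [||C [EC CV Cm]] := @fset_between _ E (out_edges (V n)) (Num.truncn (c * (v n)%:R)) EV.
  - rewrite Num.Theory.truncn_ge_nat ?mulr_ge0 // /c minr_pMl // le_min; apply/andP; split.
      apply: (le_trans Ecard); rewrite ler_wpM2r // /delta mulrAC ler_pdivrMr //.
      by rewrite ler_wpM2l ?ler_nat // ltW // divr_gt0.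
    by rewrite -natrM ler_nat -card_out_edges fsubset_leq_card.
  - rewrite -(@ler_nat R) card_out_edges natrM.
    apply: (@le_trans _ _ (c * (v n)%:R)); first by rewrite Num.Theory.truncn_le mulr_ge0.
    by rewrite ler_wpM2r // ge_min lexx orbT.
  exists [set` C]; split.
  - by move=> e /(fsubsetP CV)/out_edgesP.
  - by rewrite /ncard set_fsetK.
  - by apply: Ecomp => e; exact: (fsubsetP EC).
have /choice[E HE] := hE.
have dens : ((ncard (E n))%:R / (ncard (verts (schreier (N n) S)))%:R : R) @[n --> \oo] --> c.
  have EE n : ncard (E n) = Num.truncn (c * (v n)%:R) by have [] := HE n.
  by under eq_fun do rewrite EE; exact: cvg_truncn_density.
exists #|` ppow (sym_gens S) r|, E; split.
- rewrite cardfs_gt0; apply/fset0Pn; exists 1%g.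
  by apply: (@ppow_mono _ _ 0%N) => //; [exact: sym_gens1|exact: fset11].
- by move=> n; have [] := HE n.
- by apply/cvg_ex; exists c.
- rewrite (cvg_lim _ dens) //; apply: le_lt_trans (_ : eps / 2 < _); first by rewrite ge_min lexx.
  by lra.
- by move=> n x Vx; have [_ _] := HE n; apply.
Qed.

End PropertyAToHyperfinite.

Theorem theorem0p5 (R : realType) (Gam : groupType) (S : set Gam)
    (N : nat -> set Gam) :
  finite_set S -> generates S ->
  farber_sequence R S N ->
  graph_sequence (fun k => schreier (N k) S) ->
  (amenable Gam R <-> property_A R (fun k => schreier (N k) S)) /\
  (property_A R (fun k => schreier (N k) S) <->
   hyperfinite R (fun k => schreier (N k) S)).
Proof.
move=> finS genS farN [_ _ _ cardV]; have [_ finV _] := farN.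
have AP := amenable_property_A finS genS finV.
have PH := property_A_hyperfinite finS finV cardV.
have HA := hyperfinite_amenable finS genS farN.
by split; split; [exact: AP|move=> /PH/HA|exact: PH|move=> /HA/AP].
Qed.
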